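(* Let $G$ be a graph and let $j,k$ be positive integers. If $j \geq \mathrm{diam}(G)+k$, then $b_k(G \,\square\, K_j) = \mathrm{CL}(G\,\square\, K_j)$.
   Context: All graphs are finite, simple and undirected. $\mathrm{diam}(G)$ is the maximum distance between two vertices of $G$ (infinite if $G$ is disconnected), $K_j$ is the complete graph of order $j$, and $\square$ is the Cartesian product: $(u,v)$ and $(x,y)$ are adjacent iff $u=x$ and $vy$ is an edge, or $v=y$ and $ux$ is an edge. Cooling number: initially all vertices of $G$ are uncooled. In each round, first every uncooled vertex with a cooled neighbor becomes cooled, then one uncooled vertex (if any remains) is chosen and cooled. $\mathrm{CL}(G)$ is the maximum, over all choices, of the number of rounds until all vertices are cooled (the round in which the last vertex becomes cooled is counted). $k$-liminal burning game on $G$ ($k$ a positive integer): two players, Saboteur and Arsonist. Each vertex is burned or unburned, and revealed or unrevealed; initially all are unburned and unrevealed. In each round: (i) propagation: every unburned vertex with a neighbor burned in an earlier round becomes burned (whether revealed or not); (ii) the Saboteur reveals $k$ vertices that are unrevealed and unburned (all such vertices if fewer than $k$ exist); revealed vertices stay revealed; (iii) the Arsonist burns one revealed unburned vertex (revealed in this or any earlier round), if one exists. The game ends in the round in which all vertices are burned. The Saboteur maximizes and the Arsonist minimizes the number of rounds; $b_k(G)$ is the number of rounds under optimal play. *)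

(* Defs.v *)
From mathcomp Require Import all_boot.

Set Implicit Arguments.
Unset Strict Implicit.
Unset Printing Implicit Defensive.

Record sgraph := SGraph {
  vertex :> finType;
  adj : rel vertex;
  adj_sym : symmetric adj;
  adj_irrefl : irreflexive adj }.

Section Distance.
Variable G : sgraph.
Implicit Types x y : G.

Definition walk (n : nat) (x y : G) : bool :=
  [exists p : n.-tuple G, path (@adj G) x p && (last x p == y)].

(* The search range 0, ..., #|G| - 1 suffices for connected x and y, see gdistP;
   the value is only meaningful in that case. *)
Definition gdist (x y : G) : nat := find (fun n => walk n x y) (iota 0 #|G|).

(* None stands for an infinite diameter. *)
Definition diam : option nat :=
  if [forall x : G, forall y : G, connect (@adj G) x y]
  then Some (\max_(x : G) \max_(y : G) gdist x y)
  else None.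

Lemma gdistP x y : connect (@adj G) x y ->
  walk (gdist x y) x y /\ (forall n, walk n x y -> gdist x y <= n).
Proof.
move=> /connectP[p0 path_p0 ->]; case/shortenP: path_p0 => p path_p uniq_p _ {p0}.
set y0 := last x p.
have size_p : size p < #|G|.
  by have := max_card (mem (x :: p)); rewrite (card_uniqP uniq_p).
have walk_p : walk (size p) x y0.
  by apply/existsP; exists (in_tuple p); rewrite /= path_p eqxx.
have hasw : has (fun n => walk n x y0) (iota 0 #|G|).
  by apply/hasP; exists (size p); rewrite // mem_iota.
have dlt : gdist x y0 < #|G|.
  by have := hasw; rewrite has_find size_iota.
split; first by have := nth_find 0 hasw; rewrite -/(gdist x y0) nth_iota.
move=> n walk_n; rewrite leqNgt; apply/negP => nlt.
have := before_find 0 nlt.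
by rewrite nth_iota ?(ltn_trans nlt) // add0n walk_n.
Qed.

End Distance.

Lemma neq_sym_rel (T : eqType) : symmetric (fun x y : T => x != y).
Proof. by move=> x y; rewrite eq_sym. Qed.

Lemma neq_irrefl_rel (T : eqType) : irreflexive (fun x y : T => x != y).
Proof. by move=> x; rewrite eqxx. Qed.

Definition complete_graph (j : nat) : sgraph :=
  @SGraph 'I_j (fun u v => u != v)
    (@neq_sym_rel 'I_j) (@neq_irrefl_rel 'I_j).

Section CartesianProduct.
Variables G H : sgraph.

Definition cprod_adj (a b : G * H) : bool :=
  (a.1 == b.1) && adj a.2 b.2 || (a.2 == b.2) && adj a.1 b.1.

Lemma cprod_adj_sym : symmetric cprod_adj.
Proof.
move=> a b; rewrite /cprod_adj (eq_sym a.1) (eq_sym a.2).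
by rewrite (adj_sym a.2) (adj_sym a.1).
Qed.

Lemma cprod_adj_irrefl : irreflexive cprod_adj.
Proof. by move=> a; rewrite /cprod_adj !adj_irrefl !andbF. Qed.

Definition cprod : sgraph :=
  @SGraph (G * H)%type cprod_adj cprod_adj_sym cprod_adj_irrefl.

End CartesianProduct.

Notation "G □ H" := (cprod G H) (at level 40, left associativity).
Notation "'K_ j" := (complete_graph j) (at level 8, j at level 2, format "''K_' j").

Section Processes.
Variable G : sgraph.
Implicit Types B C R S A : {set G}.

(* Simultaneous spread from the whole of B to its neighbors. *)
Definition spread (B : {set G}) : {set G} :=
  B :|: [set v | [exists u in B, adj u v]].

(* The sets that can result from adding to B one element of A not in B
   (just B if there is no such element). *)
Definition add_one (A B : {set G}) : {set {set G}} :=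
  if A \subset B then [set B] else [set v |: B | v in A :\: B].

(* Number of remaining rounds from the cooled set C, maximized over all
   choices, cut off after n rounds. *)
Fixpoint cool_rounds_upto (n : nat) (C : {set G}) : nat :=
  if n is n'.+1 then
    if C == setT then 0
    else (\max_(C' in add_one setT (spread C)) cool_rounds_upto n' C').+1
  else 0.

(* Each round cools at least one new vertex, so the cut-off is harmless: see
   cool_roundsE. *)
Definition cool_rounds (C : {set G}) : nat := cool_rounds_upto #|~: C| C.

Definition CL : nat := cool_rounds set0.

(* The minimum of F over a nonempty set A (0 if A is empty). *)
Definition min_over (I : finType) (A : {set I}) (F : I -> nat) : nat :=
  if [pick i in A] is Some i0 then F [arg min_(i < i0 in A) F i] else 0.

(* What the Saboteur may reveal when B is burned and R is revealed. *)
Definition reveals (k : nat) (B R : {set G}) : {set {set G}} :=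
  [set S : {set G} | (S \subset ~: (B :|: R))
                     && (#|S| == minn k #|~: (B :|: R)|)].

(* Minimax number of remaining rounds from burned set B and revealed set R
   at the start of a round, cut off after n rounds. *)
Fixpoint burn_rounds_upto (k n : nat) (B R : {set G}) : nat :=
  if n is n'.+1 then
    if B == setT then 0
    else (\max_(S in reveals k (spread B) R)
            min_over (add_one (R :|: S) (spread B))
                     (fun B' => burn_rounds_upto k n' B' (R :|: S))).+1
  else 0.

(* For k > 0 each round burns at least one new vertex, so the cut-off is
   harmless: see burn_roundsE. *)
Definition burn_rounds (k : nat) (B R : {set G}) : nat :=
  burn_rounds_upto k #|~: B| B R.

Definition liminal (k : nat) : nat := burn_rounds k set0 set0.

Lemma min_overP (I : finType) (A : {set I}) (F : I -> nat) i0 : i0 \in A ->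
  (exists2 i, i \in A & min_over A F = F i) /\
  (forall i, i \in A -> min_over A F <= F i).
Proof.
rewrite /min_over => Ai0; case: pickP => [i1 Ai1 | /(_ i0)]; last by rewrite Ai0.
by case: arg_minnP => // i Ai mini; split=> //; exists i.
Qed.

Lemma leq_min_over (I : finType) (A : {set I}) (F F' : I -> nat) :
  {in A, forall i, F i <= F' i} -> min_over A F <= min_over A F'.
Proof.
move=> leF; case: (set_0Vmem A) => [-> | [i0 Ai0]].
  by rewrite /min_over; case: pickP => // i; rewrite inE.
have [_ leFm] := min_overP F Ai0; have [[i Ai ->] _] := min_overP F' Ai0.
exact: leq_trans (leFm i Ai) (leF i Ai).
Qed.

Lemma eq_min_over (I : finType) (A : {set I}) (F F' : I -> nat) :
  {in A, F =1 F'} -> min_over A F = min_over A F'.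
Proof.
move=> eqF; apply/eqP; rewrite eqn_leq.
by apply/andP; split; apply: leq_min_over => i Ai; rewrite (eqF i Ai).
Qed.

Lemma add_one_decr A B B' : B != setT -> (A \subset spread B -> spread B = setT) ->
  B' \in add_one A (spread B) -> #|~: B'| < #|~: B|.
Proof.
move=> BnT AT B'in.
suff: B \proper B' by rewrite -properC; apply: proper_card.
have sBs : B \subset spread B by apply: subsetUl.
move: B'in; rewrite /add_one; case: ifP => [/AT-> | _].
  by rewrite inE => /eqP->; rewrite properEneq BnT subsetT.
case/imsetP=> v; rewrite inE => /andP[vNs _] ->.
apply/properP; split; first by rewrite (subset_trans sBs) ?subsetUr.
exists v; rewrite ?setU11 //; apply: contra vNs; exact: (subsetP sBs).
Qed.

Lemma reveals_some k B R S : 0 < k -> S \in reveals k B R ->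
  R :|: S \subset B -> B = setT.
Proof.
move=> k_gt0; rewrite inE subUset => /andP[sS /eqP cS] /andP[sRB sSB].
have S0 : S = set0.
  apply/setP=> v; rewrite inE; apply/negP=> Sv; have := subsetP sS v Sv.
  by rewrite !inE (subsetP sSB).
move: cS; rewrite S0 cards0 (setUidPl sRB) => /esym/eqP.
rewrite minnC /minn; case: ifP => _; last by rewrite eqn0Ngt k_gt0.
by rewrite cards_eq0 -setCT (inj_eq (@setC_inj _)) => /eqP.
Qed.

Lemma cool_rounds_upto_eq n m C : #|~: C| <= n -> #|~: C| <= m ->
  cool_rounds_upto n C = cool_rounds_upto m C.
Proof.
have end0 D i : #|~: D| <= 0 -> cool_rounds_upto i D = 0.
  rewrite leqn0 cards_eq0 -setCT (inj_eq (@setC_inj _)) => DT.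
  by case: i => //= i; rewrite DT.
elim: n m C => [|n IHn] m C Cn Cm; first by rewrite !end0.
case: m Cm => [|m] Cm; first by rewrite !end0.
rewrite /=.
case: ifP => // /negbT CnT; congr _.+1; apply: eq_bigr => C' C'in.
have lt : #|~: C'| < #|~: C|.
  by apply: add_one_decr C'in; rewrite // subTset => /eqP.
by apply: IHn; rewrite -ltnS (leq_trans lt).
Qed.

Lemma cool_roundsE C : cool_rounds C =
  if C == setT then 0
  else (\max_(C' in add_one setT (spread C)) cool_rounds C').+1.
Proof.
rewrite {1}/cool_rounds (@cool_rounds_upto_eq _ #|~: C|.+1) //=.
case: ifP => // /negbT CnT; congr _.+1; apply: eq_bigr => C' C'in.
apply: cool_rounds_upto_eq => //; apply: ltnW.
by apply: add_one_decr C'in; rewrite // subTset => /eqP.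
Qed.

Lemma burn_rounds_upto_eq k n m B R : 0 < k -> #|~: B| <= n -> #|~: B| <= m ->
  burn_rounds_upto k n B R = burn_rounds_upto k m B R.
Proof.
move=> k_gt0.
have end0 D Q i : #|~: D| <= 0 -> burn_rounds_upto k i D Q = 0.
  rewrite leqn0 cards_eq0 -setCT (inj_eq (@setC_inj _)) => DT.
  by case: i => //= i; rewrite DT.
elim: n m B R => [|n IHn] m B R Bn Bm; first by rewrite !end0.
case: m Bm => [|m] Bm; first by rewrite !end0.
rewrite /=.
case: ifP => // /negbT BnT; congr _.+1; apply: eq_bigr => S Sin.
apply: eq_min_over => B' B'in.
have lt : #|~: B'| < #|~: B|.
  by apply: add_one_decr B'in => //; apply: reveals_some Sin.
by apply: IHn; rewrite -ltnS (leq_trans lt).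
Qed.

Lemma burn_roundsE k B R : 0 < k -> burn_rounds k B R =
  if B == setT then 0
  else (\max_(S in reveals k (spread B) R)
          min_over (add_one (R :|: S) (spread B))
                   (fun B' => burn_rounds k B' (R :|: S))).+1.
Proof.
move=> k_gt0; rewrite {1}/burn_rounds (@burn_rounds_upto_eq _ _ #|~: B|.+1) //=.
case: ifP => // /negbT BnT; congr _.+1; apply: eq_bigr => S Sin.
apply: eq_min_over => B' B'in; apply: burn_rounds_upto_eq => //; apply: ltnW.
by apply: add_one_decr B'in => //; apply: reveals_some Sin.
Qed.

End Processes.

Arguments diam G : clear implicits.
Arguments CL G : clear implicits.
Arguments liminal G k : clear implicits.

(* Main.v *)
Require Import Defs.
From mathcomp Require Import all_boot.

(** Every play of the burning game is a play of the cooling process, so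
    [b_k <= CL]. For [k = 1] the Saboteur dictates the burned vertex, whence
    equality. For [k >= 2] both numbers equal [d + 2]: on the one hand any first
    vertex reaches everything within distance [d + 1]; on the other hand the
    Saboteur fixes [u] of eccentricity [d] and reveals in round [t + 1] only
    vertices of one fiber [{w} x K_j] with [dist u w = t]. The burned part of
    that fiber then lies in at most [t] layers, hence [k] vertices are available
    for [t <= d], and whatever the Arsonist burns, the fire sets the rest of the
    fiber ablaze in the next round, so no revealed vertex is ever left over. *)

Set Implicit Arguments.
Unset Strict Implicit.
Unset Printing Implicit Defensive.

(** * Graph distances and the diameter *)

Section Distance.
Variable G : sgraph.
Implicit Types x y z : G.

Lemma walkS n x y z : walk n x y -> adj y z -> walk n.+1 x z.
Proof.
case/existsP=> p /andP[pth /eqP lst] yz; apply/existsP.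
exists [tuple of rcons p z].
by rewrite /= rcons_path pth lst yz last_rcons eqxx.
Qed.

Lemma walkSE n x z : walk n.+1 x z -> exists2 y, walk n x y & adj y z.
Proof.
case/existsP=> p /andP[pth /eqP lst].
case: p pth lst => p; case/lastP: p => [|p y] //= szp.
have szn : size p == n by rewrite size_rcons eqSS in szp.
rewrite rcons_path last_rcons => /andP[pth yz] yE; subst z.
exists (last x p) => //; apply/existsP; exists (Tuple szn).
by rewrite /= pth eqxx.
Qed.

Lemma walk0 x y : walk 0 x y = (x == y).
Proof.
apply/existsP/eqP => [[p]|->]; last by exists [tuple]; rewrite /= eqxx.
by rewrite tuple0 /= => /eqP.
Qed.

Hypothesis conn : forall x y, connect (@adj G) x y.

Lemma gdist_adj x y z : adj y z -> gdist x z <= (gdist x y).+1.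
Proof.
move=> yz; have [wy _] := gdistP (conn x y); have [_ le] := gdistP (conn x z).
exact/le/(walkS wy).
Qed.

Lemma gdist_pred x z n : gdist x z = n.+1 -> exists y, gdist x y = n.
Proof.
move=> dz; have [wz _] := gdistP (conn x z); rewrite dz in wz.
have [y wy yz] := walkSE wz; exists y; apply/eqP; rewrite eqn_leq.
have [_ -> //] := gdistP (conn x y).
by rewrite -ltnS -dz gdist_adj.
Qed.

(** A shortest walk to [z] meets every smaller distance from [x]; step back along it with
    [gdist_pred]. *)
Lemma gdist_surj x z n : n <= gdist x z -> exists y, gdist x y = n.
Proof.
move=> nz; rewrite -(subKn nz); elim: (_ - n) => [|m [y dy]].
  by rewrite subn0; exists z.
rewrite subnS; case: (_ - m) dy => [|p] /= dy; first by exists y.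
exact: gdist_pred dy.
Qed.

End Distance.

Lemma diam_conn (G : sgraph) d :
  diam G = Some d -> forall x y : G, connect (@adj G) x y.
Proof.
by rewrite /diam; case: ifP => // /forallP cG _ x y; apply/(forallP (cG x)).
Qed.

Lemma gdist_le_diam (G : sgraph) d (x y : G) : diam G = Some d -> gdist x y <= d.
Proof.
rewrite /diam; case: ifP => // _ [<-].
apply: leq_trans (leq_bigmax x).
exact: leq_bigmax y.
Qed.

Lemma diam_attained (G : sgraph) d (x0 : G) :
  diam G = Some d -> exists x y : G, gdist x y = d.
Proof.
rewrite /diam; case: ifP => // _ [<-].
have G0 : 0 < #|G| by apply/card_gt0P; exists x0.
have [x ->] := eq_bigmax (fun x : G => \max_(y : G) gdist x y) G0.
by have [y ->] := eq_bigmax (fun y : G => gdist x y) G0; exists x, y.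
Qed.

(** * Cooling and burning on an arbitrary graph *)

Section Processes.
Variable G : sgraph.
Implicit Types A B C R S : {set G}.

Lemma sub_spread B : B \subset spread B.
Proof. exact: subsetUl. Qed.

Lemma spreadS B C : B \subset C -> spread B \subset spread C.
Proof.
move=> BC; apply: setUSS => //; apply/subsetP=> v; rewrite !inE.
case/existsP=> u /andP[Bu uv]; apply/existsP; exists u.
by rewrite (subsetP BC).
Qed.

Lemma mem_spread B u v : u \in B -> adj u v -> v \in spread B.
Proof.
by move=> Bu uv; rewrite !inE; apply/orP; right; apply/existsP; exists u; rewrite Bu.
Qed.

Lemma spread0 : spread (set0 : {set G}) = set0.
Proof.
apply/setP=> v; rewrite !inE; apply/negbTE/existsP => -[u].
by rewrite inE.
Qed.

Lemma spreadT : spread [set: G] = setT.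
Proof. by apply/eqP; rewrite -subTset sub_spread. Qed.

Lemma iter_spreadS n B C : B \subset C -> iter n (@spread G) B \subset iter n (@spread G) C.
Proof. by move=> BC; elim: n => //= n; apply: spreadS. Qed.

Lemma iter_spread_leq m n B :
  m <= n -> iter m (@spread G) B \subset iter n (@spread G) B.
Proof.
move/subnK <-; elim: (n - m) => // p IHp.
by rewrite addSn iterS (subset_trans IHp) ?sub_spread.
Qed.

Lemma add_oneP A B B' :
  reflect (A \subset B /\ B' = B \/ exists v, [/\ v \in A, v \notin B & B' = v |: B])
          (B' \in add_one A B).
Proof.
rewrite /add_one; case: ifP => AB.
  rewrite inE; apply: (iffP eqP) => [->|[[]|[v [vA vB _]]]] //; first by left.
  by rewrite (subsetP AB) in vB.
apply: (iffP imsetP) => [[v]|[[]|[v [vA vB ->]]]] //.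
  by rewrite inE => /andP[vB vA] ->; right; exists v.
by exists v; rewrite // inE vB.
Qed.

Lemma add_one_sub A B B' : B' \in add_one A B -> B \subset B'.
Proof. by case/add_oneP => [[_ ->]|[v [_ _ ->]]] //; apply: subsetUr. Qed.

Lemma add_one_neq0 A B : exists B', B' \in add_one A B.
Proof.
case: (boolP (A \subset B)) => [AB|/subsetPn[v vA vB]].
  by exists B; apply/add_oneP; left.
by exists (v |: B); apply/add_oneP; right; exists v.
Qed.

Lemma leq_min_add_one A B n (F : {set G} -> nat) :
  (forall B', B' \in add_one A B -> n <= F B') -> n <= min_over (add_one A B) F.
Proof.
move=> le; have [B0 B0in] := add_one_neq0 A B.
by have [[B' B'in ->] _] := min_overP F B0in; apply: le.
Qed.

Lemma cool_roundsT : cool_rounds [set: G] = 0.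
Proof. by rewrite cool_roundsE eqxx. Qed.

(** Chosen vertices only enlarge the cooled set, so every play keeps up with pure spreading from
    [C]. *)
Lemma cool_rounds_iter_spread n C : iter n (@spread G) C = setT -> cool_rounds C <= n.
Proof.
elim: n C => [|n IHn] C /=; first by move->; rewrite cool_roundsT.
rewrite -iterS iterSr cool_roundsE => CT; case: ifP => // _.
rewrite ltnS; apply/bigmax_leqP => C' C'in; apply: IHn.
by apply/eqP; rewrite -subTset -CT iter_spreadS // (add_one_sub C'in).
Qed.

(** The extra round is the first one, where nothing spreads and a single vertex is cooled. *)
Lemma CL_leq n : (forall x : G, iter n (@spread G) [set x] = setT) -> CL G <= n.+1.
Proof.
move=> rad; rewrite /CL cool_roundsE; case: ifP => // C0.
rewrite ltnS spread0; apply/bigmax_leqP => C'.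
case/add_oneP => [[]|[v [_ _ ->]]]; first by rewrite subTset C0.
by rewrite setU0; apply: cool_rounds_iter_spread.
Qed.

(** Whatever has been revealed, any answer of the Arsonist is also a legal choice in the cooling
    process. *)
Lemma burn_leq_cool k B R : 0 < k -> burn_rounds k B R <= cool_rounds B.
Proof.
move=> k0; have [n] := ubnP #|~: B|; elim: n B R => // n IHn B R Bn.
rewrite burn_roundsE // cool_roundsE; case: ifP => // /negbT BT.
rewrite ltnS; apply/bigmax_leqP => S Sin.
have [B' B'in] := add_one_neq0 (R :|: S) (spread B).
have [_ le] := min_overP (fun B' => burn_rounds k B' (R :|: S)) B'in.
apply: leq_trans (le _ B'in) _; have dec := reveals_some k0 Sin.
apply: leq_trans (IHn _ _ _) _.
  by have := add_one_decr BT dec B'in; move/leq_trans; apply; rewrite -ltnS.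
apply: (bigmax_sup B') => //; apply/add_oneP.
(* With no revealed vertex left to burn, [dec] gives [spread B = setT], so the cooling process has
   no choice left either. *)
case/add_oneP: B'in => [[/dec-> ->]|[v [_ vB ->]]]; first by left.
by right; exists v.
Qed.

Lemma reveals_sub k B R S :
  R \subset B -> S \subset ~: B -> #|S| = k -> S \in reveals k B R.
Proof.
move=> /setUidPl RB SB cS; rewrite inE RB SB cS; apply/eqP/esym/minn_idPl.
by rewrite -cS subset_leq_card.
Qed.

(** The Saboteur reveals the vertex that the cooling process would choose. As [R] lies in
    [spread B], it is the only revealed unburned vertex, so the Arsonist must burn it. *)
Lemma cool_leq_burn1 B R : R \subset spread B -> cool_rounds B <= burn_rounds 1 B R.
Proof.
have [n] := ubnP #|~: B|; elim: n B R => // n IHn B R Bn RB.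
rewrite burn_roundsE // cool_roundsE; case: ifP => // /negbT BT.
rewrite ltnS; apply/bigmax_leqP => C' C'in.
have C'n : #|~: C'| < n.
  rewrite (leq_trans (add_one_decr BT _ C'in)) //.
  by rewrite subTset => /eqP.
case/add_oneP: C'in C'n => [[]|[v [_ vB ->]] C'n].
  by rewrite subTset => /eqP-> -> _; rewrite cool_roundsT.
apply: (bigmax_sup [set v]).
  by apply: reveals_sub; rewrite ?cards1 // sub1set inE.
apply: leq_min_add_one => B' /add_oneP[[]|[x [xin xB ->]]].
  by rewrite subUset sub1set (negbTE vB) andbF.
have -> : x = v.
  by move: xin; rewrite !inE => /orP[/(subsetP RB)|/eqP //]; rewrite (negbTE xB).
apply: IHn => //; rewrite subUset sub1set.
rewrite (subset_trans RB) ?(subsetP (sub_spread _)) ?setU11 //.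
by rewrite (subset_trans (subsetUr [set v] _)) ?sub_spread.
Qed.

Lemma liminal1 : liminal G 1 = CL G.
Proof.
by apply/eqP; rewrite eqn_leq burn_leq_cool //= cool_leq_burn1 ?sub0set.
Qed.

End Processes.

Lemma exists_subset_card (T : finType) (A : {set T}) k :
  k <= #|A| -> exists2 S : {set T}, S \subset A & #|S| = k.
Proof.
case/card_geqP=> s [us <- sA]; exists [set:: s]; last by rewrite cardsE; apply/card_uniqP.
by apply/subsetP=> x; rewrite inE => /sA.
Qed.

(** * The product with a complete graph *)

Section Product.
Variables (G : sgraph) (j : nat).
Local Notation H := (G □ 'K_j).
Implicit Types (x y w : G) (i l : 'I_j) (B R S : {set H}).

Lemma mem_iter_spread_layer n x y i :
  walk n x y -> ((y, i) : H) \in iter n (@spread H) [set ((x, i) : H)].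
Proof.
elim: n y => [|n IHn] y; first by rewrite walk0 => /eqP->; rewrite inE.
case/walkSE=> z /IHn zin zy; apply: mem_spread zin _.
by rewrite /= /cprod_adj /= eqxx zy orbT.
Qed.

Lemma mem_spread_fiber B y i l : ((y, i) : H) \in B -> ((y, l) : H) \in spread B.
Proof.
move=> yB; have [<-|il] := eqVneq i l; first exact: (subsetP (sub_spread B)).
by apply: mem_spread yB _; rewrite /= /cprod_adj /= eqxx il.
Qed.

Lemma CL_prod_leq d : diam G = Some d -> CL H <= d.+2.
Proof.
move=> hd; apply: CL_leq => -[x i]; apply/setP=> -[y l]; rewrite [RHS]inE.
(* The first [d] spreads fill layer [i]; the last one crosses each fiber. *)
rewrite iterS; apply: (@mem_spread_fiber _ _ i).
have [wy _] := gdistP (diam_conn hd x y).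
by apply: subsetP (mem_iter_spread_layer i wy); apply/iter_spread_leq/gdist_le_diam.
Qed.

(** Layers are not tracked inside the ball, since a fiber fills up in one round; on the sphere, [L]
    records the layers that the fire may occupy. *)
Definition front (u : G) (t : nat) (L : {set 'I_j}) : {set H} :=
  [set p : H | (gdist u p.1 < t) || (gdist u p.1 == t) && (p.2 \in L)].

Variables (k d : nat) (u : G).
Hypothesis conn : forall x y, connect (@adj G) x y.
Hypothesis k2 : 1 < k.
Hypothesis hjk : d + k <= j.
Hypothesis ecc : forall t, t <= d -> exists w, gdist u w = t.

(** An edge changes either the layer or the [G]-coordinate, so the sphere of radius [t.+1] is
    reached only along layers already present at distance [t]. *)
Lemma spread_front t B L w l : gdist u w = t -> B \subset front u t L ->
  spread (((w, l) : H) |: B) \subset front u t.+1 (l |: L).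
Proof.
move=> dw BF.
have F p : p \in ((w, l) : H) |: B ->
    gdist u p.1 < t \/ gdist u p.1 = t /\ p.2 \in l |: L.
  rewrite !inE => /orP[/eqP-> /=|]; first by right; rewrite eqxx.
  move/(subsetP BF); rewrite inE => /orP[|/andP[/eqP-> ->]]; first by left.
  by right; rewrite orbT.
apply/subsetP=> -[x m]; rewrite [_ \in spread _]inE => /orP[/F /=|].
  by rewrite [_ \in front _ _ _]inE /= ltnS => -[/ltnW->|[-> _]] //; rewrite leqnn.
rewrite inE => /existsP[[y i] /andP[/F /=]].
rewrite /cprod_adj [_ \in front _ _ _]inE /= ltnS => Fy /orP[/andP[/eqP<- _]|/andP[/eqP<-]].
  by case: Fy => [/ltnW->|[-> _]] //; rewrite leqnn.
move/(gdist_adj conn u) => le; case: Fy => [lt|[e ->]].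
  by rewrite (leq_trans le lt).
by rewrite andbT -ltnS orbC -leq_eqVlt -e.
Qed.

(* [spread B \subset front u t L] says that after [t] rounds and the following
   propagation the fire has not passed the sphere of radius [t], where it is
   confined to the layers in [L]. *)
Lemma leq_burn_front n t B R L : t + n = d -> R \subset spread B ->
  spread B \subset front u t L -> #|L| <= t -> n.+2 <= burn_rounds k B R.
Proof.
elim/ltn_ind: n t B R L => n IHn t B R L tnd RB BF Lt.
have k0 : 0 < k by apply: ltnW.
have td : t <= d by rewrite -tnd leq_addr.
have [w dw] := ecc td.
(* [L] takes up at most [t <= d] of the [j >= d + k] layers. *)
have kL : k <= #|~: L|.
  rewrite cardsCs setCK card_ord leq_subRL.
    by rewrite (leq_trans _ hjk) // leq_add2r (leq_trans Lt).
  by rewrite (leq_trans Lt) // (leq_trans td) // (leq_trans _ hjk) ?leq_addr.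
have [K KL cK] := exists_subset_card kL.
pose S : {set H} := [set ((w, l) : H) | l in K].
have cS : #|S| = k by rewrite card_imset // => l m [].
have SB : S \subset ~: spread B.
  apply/subsetP=> p /imsetP[l lK ->]; rewrite inE.
  apply/negP => /(subsetP BF); rewrite inE /= dw ltnn eqxx /=.
  by apply/negP; rewrite -in_setC (subsetP KL).
have BT : B == setT = false.
  apply/negbTE/eqP => BT; move: SB; rewrite BT spreadT setCT subset0 -cards_eq0 cS.
  by rewrite eqn0Ngt k0.
rewrite burn_roundsE // BT ltnS.
apply: (bigmax_sup S); first exact: reveals_sub.
apply: leq_min_add_one => B' /add_oneP[[]|[p [pin pB ->]]].
  (* The Arsonist cannot idle: [S] is nonempty and disjoint from [spread B]. *)
  rewrite subUset => /andP[_ /(subset_trans) SB'].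
  have : S \subset set0 by rewrite -(setICr (spread B)) subsetI SB SB'.
  by rewrite subset0 -cards_eq0 cS eqn0Ngt k0.
have {pin} pS : p \in S.
  by move: pin; rewrite inE => /orP[/(subsetP RB)|//]; rewrite (negbTE pB).
have /imsetP[l _ pE] := pS; subst p.
case: n => [|n] in IHn tnd *.
  (* At the last radius, [k >= 2] leaves a vertex of [S] unburned, which costs one more round. *)
  rewrite burn_roundsE //; case: eqP => // BT'.
  have /subset_leq_card : S \subset [set (w, l)].
    apply/subsetP=> q qS; have := subsetP SB q qS; rewrite inE.
    by have := in_setT q; rewrite -BT' !inE => /orP[//|->].
  by rewrite cS cards1 leqNgt k2.
apply: (IHn n (ltnSn n) t.+1 _ _ (l |: L)).
- by rewrite addSnnS.
- rewrite subUset; apply/andP; split.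
    apply: subset_trans RB (subset_trans _ (sub_spread _)); exact: subsetUr.
  (* The burned [(w, l)] ignites its whole fiber at the next propagation, and with it all of [S]. *)
  by apply/subsetP=> q /imsetP[m _ ->]; apply: (@mem_spread_fiber _ _ l); rewrite setU11.
- exact: spread_front.
- by rewrite cardsU1 (leq_add (leq_b1 _)).
Qed.

End Product.

Theorem theorem25 (G : sgraph) (j k d : nat) (hj : 0 < j) (hk : 0 < k)
    (hd : diam G = Some d) (hjk : d + k <= j) :
  liminal (G □ 'K_j) k = CL (G □ 'K_j).
Proof.
case: (ltngtP k 1) => [|k2|->]; [by rewrite ltnNge hk| |exact: liminal1].
apply/eqP; rewrite eqn_leq burn_leq_cool //=.
(* Without vertices there is no [u] to start from, but then [CL] is 0. *)
have [T0|[[x0 _] _]] := set_0Vmem [set: (G □ 'K_j)].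
  by rewrite /CL cool_roundsE T0 eqxx.
apply: leq_trans (CL_prod_leq j hd) _.
have conn := diam_conn hd; have [u [v uv]] := diam_attained x0 hd.
(* Start at radius 0 with nothing burned or revealed; [n = d] yields the bound [d.+2]. *)
apply: (@leq_burn_front G j k d u conn k2 hjk _ d 0 _ _ set0) => //.
- by move=> t td; apply: (@gdist_surj _ conn _ v); rewrite uv.
- exact: sub0set.
- by rewrite spread0 sub0set.
- by rewrite cards0.
Qed.
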